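(* For every integer $l \ge 1$, the 2-domination numbers of the fractal cubic networks satisfy $\gamma_2(FCN(l)) = 4\,\gamma_2(FCN(l-1))$.
   Context: Fractal cubic network: for an integer $l\ge 0$, $FCN(l)$ is the finite simple graph whose vertices are all binary strings of length $2l+2$, defined recursively as follows. $FCN(0)$ is the 4-cycle with vertices $00, 01, 11, 10$ in this cyclic order. For $l\ge 1$, $FCN(l)$ is obtained from the disjoint union of the four copies $ab\,\Vert\,FCN(l-1)$, $a,b\in\{0,1\}$ (each vertex string of $FCN(l-1)$ is prefixed by $ab$, adjacency inside a copy being that of $FCN(l-1)$), by adding the four edges $\{00w,10w\}$, $\{10w,11w\}$, $\{11w,01w\}$, $\{01w,00w\}$, where $w=10(01)^{l-1}$ is the string $10$ followed by $l-1$ repetitions of $01$. A 2-dominating set of a graph $\Gamma$ is a set $D\subseteq V(\Gamma)$ such that $|N(v)\cap D|\ge 2$ for every $v\in V(\Gamma)\setminus D$, where $N(v)$ is the open neighborhood of $v$; $\gamma_2(\Gamma)$ is the minimum size of a 2-dominating set. *)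

(* Defs.v *)
From mathcomp Require Import all_boot.

Set Implicit Arguments.
Unset Strict Implicit.
Unset Printing Implicit Defensive.

(* A finite simple graph is a symmetric irreflexive relation on its finType of
   vertices; fcn_sym and fcn_irr establish both properties for FCN(l).
   Strings are read from left to right, with 0 = false and 1 = true. *)

Definition open_nbhd (T : finType) (e : rel T) (v : T) : {set T} :=
  [set u | e v u].

Definition two_dominating (T : finType) (e : rel T) (D : {set T}) : bool :=
  [forall v, (v \notin D) ==> (2 <= #|open_nbhd e v :&: D|)].

Lemma two_dominatingT (T : finType) (e : rel T) : two_dominating e [set: T].
Proof. by apply/forallP => v; rewrite inE. Qed.

(* By two_dominatingT, [set: T] is a legitimate seed for arg min; gamma2P
   shows that the value does not depend on it. *)
Definition gamma2 (T : finType) (e : rel T) : nat :=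
  #|[arg min_(D < [set: T] | two_dominating e D) #|D|]|.

Lemma gamma2P (T : finType) (e : rel T) :
  (exists2 D, two_dominating e D & #|D| = gamma2 e) /\
  (forall D, two_dominating e D -> gamma2 e <= #|D|).
Proof.
rewrite /gamma2; case: arg_minnP => [|D domD minD]; first exact: two_dominatingT.
by split=> //; exists D.
Qed.

Definition s00 : seq bool := [:: false; false].
Definition s01 : seq bool := [:: false; true].
Definition s10 : seq bool := [:: true; false].
Definition s11 : seq bool := [:: true; true].

Definition c4_edges : seq (seq bool * seq bool) :=
  [:: (s00, s01); (s01, s11); (s11, s10); (s10, s00)].

Definition c4_adj (u v : seq bool) : bool :=
  ((u, v) \in c4_edges) || ((v, u) \in c4_edges).

(* The string 10(01)^k, of length 2k + 2. *)
Definition fcn_port (k : nat) : seq bool := s10 ++ flatten (nseq k s01).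

(* Adjacency in FCN(l), meaningful on strings of length 2l + 2.  The first
   disjunct is adjacency inside a copy ab || FCN(k); the second one is the four
   new edges, which join the copies of w = fcn_port k along the prefixes
   00, 10, 11, 01, the same cycle as FCN(0). *)
Fixpoint fcn_adj (l : nat) (u v : seq bool) : bool :=
  match l with
  | 0 => c4_adj u v
  | k.+1 =>
         (take 2 u == take 2 v) && fcn_adj k (drop 2 u) (drop 2 v)
      || [&& drop 2 u == fcn_port k, drop 2 v == fcn_port k
           & c4_adj (take 2 u) (take 2 v)]
  end.

Definition fcn (l : nat) : rel ((2 * l + 2).-tuple bool) :=
  fun u v => fcn_adj l u v.
Arguments fcn l u v : clear implicits.

Lemma size_fcn_port k : size (fcn_port k) = 2 * k + 2.
Proof.
by rewrite size_cat size_flatten /shape map_nseq sumn_nseq addnC.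
Qed.

Lemma c4_adj_sym : symmetric c4_adj.
Proof. by move=> u v; rewrite /c4_adj orbC. Qed.

Lemma c4_adj_irr : irreflexive c4_adj.
Proof.
move=> u; apply/negP; rewrite /c4_adj orbb !inE !xpair_eqE.
by do ![case/orP]; case/andP => /eqP->.
Qed.

Lemma fcn_sym l : symmetric (fcn l).
Proof.
rewrite /fcn => u v; move: (tval u) (tval v) => {}u {}v.
elim: l u v => [|l IHl] u v /=; first exact: c4_adj_sym.
by rewrite eq_sym IHl c4_adj_sym; congr orb; rewrite andbCA.
Qed.

Lemma fcn_irr l : irreflexive (fcn l).
Proof.
rewrite /fcn => u; move: (tval u) => {}u.
elim: l u => [|l IHl] u /=; first exact: c4_adj_irr.
by rewrite IHl c4_adj_irr !andbF.
Qed.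

(* Main.v *)
Require Import Defs.
From mathcomp Require Import all_boot.

(** FCN(l) is partitioned into 4^l copies of the 4-cycle FCN(0).  The strings
    that acquire extra edges always end in 01 or 10, so the vertices p00 and p11
    of each copy keep the neighborhood {p01, p10}.  A 2-dominating set thus
    contains both p00 and p11, or both p01 and p10, whence at least two vertices
    of each copy; conversely the vertices p01 and p10 form a 2-dominating set.
    Therefore gamma2 (FCN(l)) = 2 * 4^l. *)

(** The last two letters of a port differ: it ends in 10 for [k = 0] and in 01 otherwise. *)
Lemma fcn_port_neq k (p : seq bool) a : (p ++ [:: a; a] == fcn_port k) = false.
Proof.
apply/eqP; case: k => [|k]; first by case: p a => [|? [|? [|? ?]]] [].
(* The last 01 is split off, so that reversal brings the two final letters of both sides to the
   front. *)
rewrite /fcn_port -addn1 nseqD flatten_cat catA.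
by move/(congr1 rev); rewrite rev_cat [in RHS]rev_cat; case: a.
Qed.

(** Edges added at any level join ports only, so by [fcn_port_neq] a string ending in [aa] keeps
    just its two edges from the 4-cycle. *)
Lemma fcn_adj_diag l (p : seq bool) a u : size p = 2 * l ->
  fcn_adj l (p ++ [:: a; a]) u
  = (u == p ++ [:: false; true]) || (u == p ++ [:: true; false]).
Proof.
elim: l p u => [|l IHl] p u.
  by move=> /size0nil->; case: a; case: u => [|[] [|[] [|? ?]]].
rewrite mulnS; case: p => [|x [|y p]] //= [szp].
rewrite drop0 fcn_port_neq orbF IHl //.
case: u => [|x' [|y' u]] //=; rewrite !eqseq_cons ?andbF //.
by rewrite !take0 drop0 eqxx andbT -!andb_orr -andbA (eq_sym x) (eq_sym y).
Qed.

Section Blocks.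

Variable l : nat.
Local Notation vertex := ((2 * l + 2).-tuple bool).
Local Notation block := ((2 * l).-tuple bool).

Definition block_vertex (p : block) (a b : bool) : vertex :=
  cat_tuple p [tuple a; b].

Lemma block_vertexP (v : vertex) : exists p a b, v = block_vertex p a b.
Proof.
have szp : size (take (2 * l) v) == 2 * l by rewrite size_takel ?size_tuple ?leq_addr.
have := cat_take_drop (2 * l) v.
have : size (drop (2 * l) v) = 2 by rewrite size_drop size_tuple addKn.
case: (drop _ _) => [|a [|b [|? ?]]] // _ Ev.
by exists (Tuple szp), a, b; apply/val_inj; rewrite /= Ev.
Qed.

Lemma block_vertex_inj p a b q c d :
  block_vertex p a b = block_vertex q c d -> [/\ p = q, a = c & b = d].
Proof.
move=> /(congr1 val)/eqP; rewrite /= eqseq_cat ?size_tuple //.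
by case/andP=> /eqP/val_inj-> /eqP[-> ->].
Qed.

Lemma open_nbhd_diag p a :
  open_nbhd (fcn l) (block_vertex p a a)
  = [set block_vertex p false true; block_vertex p true false].
Proof. by apply/setP => u; rewrite !inE /fcn fcn_adj_diag ?size_tuple. Qed.

Lemma card_block_pair p a b c d : (a, b) != (c, d) ->
  #|[set block_vertex p a b; block_vertex p c d]| = 2.
Proof.
move=> neq; rewrite cards2; case: eqP => // /block_vertex_inj[_ Ea Eb].
by rewrite Ea Eb eqxx in neq.
Qed.

Lemma two_dominating_diag (D : {set vertex}) p a :
  two_dominating (fcn l) D -> block_vertex p a a \notin D ->
  [set block_vertex p false true; block_vertex p true false] \subset D.
Proof.
move=> /forallP/(_ (block_vertex p a a))/implyP domD /domD.
(* The neighborhood has only two elements, so two neighbors in [D] exhaust it. *)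
rewrite open_nbhd_diag => le2; apply/setIidPl/eqP.
by rewrite eqEcard subsetIl card_block_pair.
Qed.

Lemma two_dominating_block (D : {set vertex}) p : two_dominating (fcn l) D ->
  2 <= \sum_a \sum_b (block_vertex p a b \in D).
Proof.
move=> domD; rewrite !big_bool /=.
have [D11|/two_dominating_diag] := boolP (block_vertex p true true \in D); last first.
  by move=> /(_ domD); rewrite subUset !sub1set => /andP[-> ->]; rewrite addnAC addnC.
have [D00|/two_dominating_diag] := boolP (block_vertex p false false \in D).
  by rewrite addnAC addnA; case: (_ \in D); case: (_ \in D).
by move=> /(_ domD); rewrite subUset !sub1set => /andP[-> ->].
Qed.

(** Cutting off the last two letters is a bijection, so both bounds on [gamma2] can be checked one
    4-cycle at a time. *)
Lemma card_blocks (D : {set vertex}) :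
  #|D| = \sum_p \sum_a \sum_b (block_vertex p a b \in D).
Proof.
pose f (x : block * (bool * bool)) := block_vertex x.1 x.2.1 x.2.2.
have f_bij : bijective f.
  (* Injectivity suffices, since both sides have [2 ^ (2 * l + 2)] elements. *)
  apply: inj_card_bij => [[p [a b]] [q [c d]] /block_vertex_inj[/= -> -> ->]//|].
  by rewrite !card_prod !card_tuple !card_bool expnD.
rewrite -sum1_card big_mkcond /= (reindex f) /=; last exact: onW_bij.
under [RHS]eq_bigr do rewrite pair_big /=.
by rewrite pair_big /=; apply: eq_bigr => x _; rewrite /f; case: (_ \in D).
Qed.

Definition offdiag : {set vertex} :=
  [set v | [exists p, exists a, v == block_vertex p a (~~ a)]].

Lemma mem_offdiag p a b : (block_vertex p a b \in offdiag) = (a != b).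
Proof.
rewrite inE; apply/idP/idP.
  by case/existsP=> q /existsP[c /eqP/block_vertex_inj[_ -> ->]]; case: c.
move=> neq; apply/existsP; exists p; apply/existsP; exists a.
by case: a b neq => [] [].
Qed.

(** Every vertex outside [offdiag] ends in [aa], and both of its neighbors lie in [offdiag]. *)
Lemma two_dominating_offdiag : two_dominating (fcn l) offdiag.
Proof.
apply/forallP => v; apply/implyP; have [p [a [b ->]]] := block_vertexP v.
rewrite mem_offdiag negbK => /eqP <-; rewrite open_nbhd_diag (setIidPl _).
  by rewrite card_block_pair.
by rewrite subUset !sub1set !mem_offdiag.
Qed.

Lemma gamma2_fcn : gamma2 (fcn l) = 2 * 4 ^ l.
Proof.
have [[D domD cardD] minD] := gamma2P (fcn l).
(* Two vertices for each of the [2 ^ (2 * l)] blocks. *)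
have sum2 : \sum_(p : block) 2 = 2 * 4 ^ l.
  by rewrite sum_nat_const card_tuple card_bool expnM mulnC.
apply/eqP; rewrite eqn_leq -sum2; apply/andP; split.
  apply: leq_trans (minD _ two_dominating_offdiag) _.
  rewrite card_blocks; apply: leq_sum => p _.
  by rewrite !big_bool /= !mem_offdiag.
by rewrite -cardD card_blocks; apply: leq_sum => p _; apply: two_dominating_block.
Qed.

End Blocks.

Theorem theorem26 (l : nat) (hl : 1 <= l) :
  gamma2 (fcn l) = 4 * gamma2 (fcn (l - 1)).
Proof. by case: l hl => // l _; rewrite subn1 !gamma2_fcn expnS mulnCA. Qed.
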